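(* Let $k\geq 2$ and $n\geq 1$ be integers. If $X$ is a metric space with $\dim X=kn$, then $\partial\Delta^k\text{-}\mathrm{Ind}\,X=n$ and $\partial\Delta^k\text{-}\mathrm{str}\,X=0$.
   Context: $\dim$ is covering dimension. $\Delta^k$ is the $k$-dimensional simplex with vertices $e_0,\dots,e_k$; $K=\partial\Delta^k$ is the simplicial complex of all its faces of dimension at most $k-1$. $K$-tuples. For $K=\partial\Delta^k$, a $K$-tuple of a space $X$ is a $(k+1)$-tuple $\mathcal A=(A_0,\dots,A_k)$ of subsets of $X$ with $\bigcap_{i=0}^kA_i=\emptyset$. It is open (closed) if all $A_i$ are. $\bigcup\mathcal A=\bigcup_iA_i$. If $\mathcal A$ is an open $K$-tuple and $B_i\subset A_i$ for all $i$, then $\mathcal A$ is a $K$-neighbourhood of $\mathcal B=(B_0,\dots,B_k)$ and $P=X\setminus\bigcup\mathcal A$ is a $K$-partition for $\mathcal B$. $K\text{-}\mathrm{Ind}$ (normal $X$; values: ordinals, $-1$, $\infty$): $K\text{-}\mathrm{Ind}\,X=-1$ iff $X=\emptyset$; for an ordinal $\alpha$, $K\text{-}\mathrm{Ind}\,X\le\alpha$ iff every closed $K$-tuple of $X$ has a $K$-partition $P$ with $K\text{-}\mathrm{Ind}\,P<\alpha$; for $X\neq\emptyset$ the value is the least such ordinal $\alpha$, or $\infty$ if none. Obstruction points and strength degree. For an open $K$-tuple $\mathcal U$ of $X$, $K\text{-}\mathrm{obs}\,\mathcal U$ is the set of points $x\in X$ such that $\mathcal U$ has no $K$-neighbourhood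 $\mathcal V$ with $x\in\bigcup\mathcal V$. $K\text{-}\mathrm{str}\,X\in\{0,1\}$: if $\alpha=K\text{-}\mathrm{Ind}\,X\in\{-1,0,\infty\}$, then $K\text{-}\mathrm{str}\,X=0$. If $0<\alpha<\infty$, then $K\text{-}\mathrm{str}\,X=0$ when every closed $K$-tuple of $X$ has a $K$-neighbourhood $\mathcal U$ with $K\text{-}\mathrm{obs}\,\mathcal U=\emptyset$ and $K\text{-}\mathrm{Ind}(X\setminus\bigcup\mathcal U)<\alpha$, and $K\text{-}\mathrm{str}\,X=1$ otherwise. *)

(* Defs.v *)
From HB Require Import structures.
From mathcomp Require Import all_boot all_order all_algebra.
From mathcomp Require Import all_classical all_reals.
From mathcomp Require Import topology.

Set Implicit Arguments.
Unset Strict Implicit.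
Unset Printing Implicit Defensive.

Local Open Scope classical_set_scope.

(* Ordinals as well-founded trees: [osup f] denotes the least ordinal strictly
   greater than every [f i].  Distinct trees may denote the same ordinal, so
   equality of ordinals is [oeq] and not Leibniz equality. *)
Inductive ord : Type := osup (J : Type) (f : J -> ord).

Fixpoint ole (a b : ord) : Prop :=
  match a, b with
  | osup J f, osup L g => forall i : J, exists j : L, ole (f i) (g j)
  end.

Definition olt (a b : ord) : Prop :=
  let: osup L g := b in exists j : L, ole a (g j).

Definition oeq (a b : ord) : Prop := ole a b /\ ole b a.

Fixpoint ord_of_nat (n : nat) : ord :=
  if n is m.+1 then osup (fun _ : unit => ord_of_nat m)
  else osup (fun e : Empty_set => match e with end).

Lemma ole_refl a : ole a a.
Proof. by elim: a => J f IH /= i; exists i. Qed.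

Lemma ole_trans a b c : ole a b -> ole b c -> ole a c.
Proof.
elim: a b c => J f IH [L g] [U h] /= ab bc i.
have [j ij] := ab i; have [l jl] := bc j.
by exists l; exact: IH ij jl.
Qed.

Lemma ole_total a b : ole a b \/ olt b a.
Proof.
elim: a b => J f IH [L g] /=.
have [|/existsNP[i /forallNP nj]] :=
  pselect (forall i, exists j, ole (f i) (g j)); first by left.
right; exists i; case fE : (f i) => [U h] j.
by have [/nj//|] := IH i (g j); rewrite fE.
Qed.

Lemma olt_wf : well_founded olt.
Proof.
suff acc b a : ole a b -> Acc olt a by move=> a; exact: acc (ole_refl a).
elim: b a => L g IH [J f] /= le; constructor=> c /= [i ci].
have [j ij] := le i; apply: (IH j); exact: ole_trans ci ij.
Qed.

(* Values of a dimension function: -1, a number (natural or ordinal), infinity. *)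
Inductive dimval (T : Type) : Type := MinusOne | Val of T | Infty.
Arguments MinusOne {T}.
Arguments Infty {T}.

Definition dimval_lt T (lt : T -> T -> Prop) (v w : dimval T) : Prop :=
  match v, w with
  | MinusOne, MinusOne => False
  | MinusOne, _ => True
  | Val a, Val b => lt a b
  | Val _, Infty => True
  | _, _ => False
  end.

Definition dimval_eq T (eqv : T -> T -> Prop) (v w : dimval T) : Prop :=
  match v, w with
  | MinusOne, MinusOne => True
  | Val a, Val b => eqv a b
  | Infty, Infty => True
  | _, _ => False
  end.

(* -1 for the empty space; otherwise the least [a] with [dim_le a], and
   infinity if there is no such [a]. *)
Definition dim_value T (le : T -> T -> Prop) (X : Type) (dim_le : T -> Prop) :
    dimval T :=
  if pselect ([set: X] = set0) is left _ then MinusOne else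
  if pselect (exists a, dim_le a /\ forall b, dim_le b -> le a b) is left e
  then Val (sval (cid e)) else Infty.

Section CoveringDimension.
Variable X : topologicalType.

Definition open_cover m (U : 'I_m -> set X) : Prop :=
  (forall i, open (U i)) /\ \bigcup_i U i = [set: X].

Definition refines m p (V : 'I_p -> set X) (U : 'I_m -> set X) : Prop :=
  forall j, exists i, V j `<=` U i.

(* Order at most n: no point lies in more than n + 1 members of the family. *)
Definition order_le m (V : 'I_m -> set X) (n : nat) : Prop :=
  forall x, (#|[pred i | `[< V i x >]]| <= n.+1)%N.

Definition covdim_le (n : nat) : Prop :=
  forall m (U : 'I_m -> set X), open_cover U ->
  exists p (V : 'I_p -> set X), [/\ open_cover V, refines V U & order_le V n].

Definition covdim : dimval nat :=
  dim_value (fun m n => (m <= n)%N) X covdim_le.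

End CoveringDimension.

(* K is the boundary of the k-simplex throughout. *)
Section KTuples.
Variables (k : nat) (X : topologicalType).
Implicit Types A B U V : 'I_k.+1 -> set X.

Definition Ktuple A : Prop := \bigcap_i A i = set0.

Definition open_Ktuple A : Prop := Ktuple A /\ forall i, open (A i).

Definition closed_Ktuple A : Prop := Ktuple A /\ forall i, closed (A i).

Definition Kneighbourhood A B : Prop :=
  open_Ktuple A /\ forall i, B i `<=` A i.

Definition Kpartition (P : set X) B : Prop :=
  exists2 A, Kneighbourhood A B & P = ~` \bigcup_i A i.

Definition Kobs U : set X :=
  [set x | ~ exists2 V, Kneighbourhood V U & (\bigcup_i V i) x].

End KTuples.

(* K-Ind X <= a; the value K-Ind X is defined from it afterwards, and [KInd_leE]
   recovers the recursive definition.  A subset [P : set X], coerced to a type,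
   carries the subspace topology. *)
Inductive KInd_le (k : nat) (a : ord) (X : topologicalType) : Prop :=
  KInd_le_intro of
    (forall A : 'I_k.+1 -> set X, closed_Ktuple A ->
     exists2 P : set X, Kpartition P A &
       P = set0 \/ exists2 b, olt b a & KInd_le k b P).

Definition KInd (k : nat) (X : topologicalType) : dimval ord :=
  dim_value ole X (fun a => KInd_le k a X).

Lemma KInd_ltP k (X : topologicalType) (P : set X) a :
  dimval_lt olt (KInd k P) (Val a) <->
  P = set0 \/ exists2 b, olt b a & KInd_le k b P.
Proof.
have P0 : ([set: P] = set0) <-> (P = set0).
  split=> [P0|->]; last first.
    by rewrite -subset0 => -[x xP] _; have := set_mem xP.
  rewrite -subset0 => x Px.
  by have : [set: P] (exist _ x (mem_set Px)) by []; rewrite P0.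
rewrite /KInd /dim_value; case: pselect => [/P0 P0'|nP0].
  by split=> // _; left.
case: pselect => [e|ne] /=.
  case: (cid e) => c [/= cP cmin]; split=> [ca|[/P0//|[b ba bP]]].
    by right; exists c.
  case: a ba => L g /= [j bj]; exists j; exact: ole_trans (cmin _ bP) bj.
split=> // -[/P0//|[b _ bP]]; case: ne.
elim/(well_founded_ind olt_wf): b bP => b IH bP.
have [[c cb cP]|nc] := pselect (exists2 c, olt c b & KInd_le k c P).
  exact: IH cb cP.
exists b; split=> // c cP; have [//|cb] := ole_total b c.
by case: nc; exists c.
Qed.

Lemma KInd_leE k (X : topologicalType) a :
  KInd_le k a X <->
  forall A : 'I_k.+1 -> set X, closed_Ktuple A ->
  exists2 P : set X, Kpartition P A & dimval_lt olt (KInd k P) (Val a).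
Proof.
split=> [[H] A /H[P PA PK]|H]; last split=> A /H[P PA PK].
  by exists P => //; apply/KInd_ltP.
by exists P => //; apply/KInd_ltP.
Qed.

Definition Kstr (k : nat) (X : topologicalType) : nat :=
  if KInd k X is Val a then
    if `[< oeq a (ord_of_nat 0) \/
           forall A : 'I_k.+1 -> set X, closed_Ktuple A ->
           exists U : 'I_k.+1 -> set X,
             [/\ Kneighbourhood U A, Kobs U = set0 &
                 dimval_lt olt (KInd k (~` \bigcup_i U i : set X)) (Val a)] >]
    then 0 else 1
  else 0.

(* Main.v *)
Require Import Defs.
From mathcomp Require Import all_boot all_order all_algebra.
From mathcomp Require Import all_classical all_reals.
From mathcomp Require Import topology wochoice.

(** A closed K-tuple of a space is the same as an open cover by k + 1 sets, by
complements, and a K-partition of it is the common part of a closed shrinking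
of that cover.  Both bounds on K-Ind count how much dimension the common part
of such a shrinking can lose: exactly k at each step.

Upper bound.  A metric space X with dim X <= N is the union of N + 1
zero-dimensional subsets ([zero_dim_decomposition]).  A closed K-tuple can be
given a K-partition that avoids any k zero-dimensional sets
([Kneighbourhood_avoiding]): choose the boundaries of k neighbourhoods so that
the j-th of them misses the j-th set, and put the partition inside the
intersection of these boundaries.  Thus each step down in K-Ind uses up k of
the sets, and k (m + 1) zero-dimensional sets give K-Ind <= m
([KInd_le_of_zero_dim]).  Since k n + 1 <= k (n + 1), K-Ind X <= n when
dim X = k n.

Strength degree.  Here only one of the k n + 1 sets has to be avoided, because
k n sets already give K-Ind <= n - 1.  With this much freedom the partition can
be taken to be a boundary separating the tuple from the rest of the space, and
the other side of that boundary is handed to a single member of the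
K-neighbourhood.  For k >= 2 this leaves no obstruction points
([Kneighbourhood_unobstructed]).

Lower bound.  If K-Ind X <= n - 1 then every open cover of X by k n + 1 sets
has an open shrinking without a common point: lump all but k of the sets
together, apply the definition of K-Ind to the resulting k + 1 sets, and treat
the remaining sets on the K-partition by induction ([cover_shrinkable_join]).
Merging the members of a finite cover into k n + 1 groups turns this into
dim X <= k n - 1 ([covdim_le_of_shrinkable]), against dim X = k n.

Decomposition.  For countably many pairs of disjoint closed sets, covering
dimension at most N yields partitions of which no N + 1 have a common point
([partitions_sequence]).  In a metric space countably many pairs suffice to
carry a whole base of neighbourhoods, because A. H. Stone's construction
arranges a base into countably many families of disjoint open sets
([labelled_base]).  The set of the points that lie on exactly j of the
partitions is then zero-dimensional: the points with j prescribed partitions lie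
on none of the remaining ones, which still bound a base of neighbourhoods, and a
countable sum theorem ([zero_dim_bigcup]) puts these pieces together. *)

Set Implicit Arguments.
Unset Strict Implicit.
Unset Printing Implicit Defensive.

Local Open Scope classical_set_scope.

(** * Shrinking and swelling of finite covers in normal spaces *)

Lemma open_bigcap_fin (T : topologicalType) (I : choiceType) (D : set I)
    (F : I -> set T) : finite_set D -> (forall i, D i -> open (F i)) ->
  open (\bigcap_(i in D) F i).
Proof.
move=> finD oF; rewrite -closedC setC_bigcap; apply: closed_bigcup => // i Di.
by rewrite closedC; exact: oF.
Qed.

Lemma nclosure_open (T : topologicalType) (U V : set T) :
  open V -> U `<=` ~` V -> closure U `<=` ~` V.
Proof.
move=> oV UV; have /closure_id -> : closed (~` V) by rewrite closedC.
exact: closureS.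
Qed.

Section Normal.
Variable T : topologicalType.
Hypothesis nT : normal_space T.

Lemma normal_between (F O : set T) : closed F -> open O -> F `<=` O ->
  exists W, [/\ open W, F `<=` W & closure W `<=` O].
Proof.
move=> cF oO FO; have FO' : set_nbhs F O by apply/set_nbhsP; exists O; split.
have [B /(set_nbhsP F B)[C [oC FC CB]] BO] := nT cF FO'.
by exists C; split=> //; apply: subset_trans BO; exact: closureS.
Qed.

Lemma normal_separate (A B : set T) : closed A -> closed B -> A `<=` ~` B ->
  exists U V, [/\ open U, open V, A `<=` U, B `<=` V &
    closure U `<=` ~` closure V].
Proof.
move=> cA cB AB; have oB : open (~` B) by rewrite openC.
have [U [oU AU UB]] := normal_between cA oB AB.
have oU' : open (~` closure U) by rewrite openC; exact: closed_closure.
have BU : B `<=` ~` closure U by move=> x Bx /UB; apply.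
have [V [oV BV VU]] := normal_between cB oU' BU.
by exists U, V; split=> // x Ux /VU; apply.
Qed.

(** The part of F outside the first M sets is closed and lies in the last one,
so it has a neighbourhood W whose closure still does; F minus W is covered by
the first M sets. *)
Lemma closed_shrinking (M : nat) (O : nat -> set T) (F : set T) :
  (forall i, open (O i)) -> closed F ->
  (forall x, F x -> exists2 i, (i < M)%N & O i x) ->
  exists C : nat -> set T, [/\ forall i, closed (C i), forall i, C i `<=` O i &
    forall x, F x -> exists2 i, (i < M)%N & C i x].
Proof.
elim: M F => [|M IH] F oO cF FO.
  exists (fun=> set0); split=> [i|i x []|x /FO[]//]; exact: closed0.
pose G := F `&` \bigcap_(i in `I_M) ~` O i.
have cG : closed G.
  by apply: closedI => //; apply: closed_bigI => i _; rewrite closedC.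
have GO : G `<=` O M.
  move=> x [/FO[i]]; rewrite ltnS leq_eqVlt => /predU1P[-> //|iM Oix /(_ i iM)].
  by [].
have [W [oW GW WO]] := normal_between cG (oO M) GO.
have cF' : closed (F `&` ~` W) by apply: closedI => //; rewrite closedC.
have [|C [cC CO FC]] := IH _ oO cF'.
  move=> x [Fx nWx]; apply: contrapT => nO; apply/nWx/GW; split=> // i /= iM Oix.
  by apply: nO; exists i.
exists (fun i => if i == M then closure W else C i); split=> [i|i|x Fx].
- by case: eqP => // _; exact: closed_closure.
- by case: eqP => [->|].
have [Wx|nWx] := pselect (W x).
  by exists M => //; rewrite eqxx; exact: subset_closure.
have [//|i iM Cx] := FC x; exists i; first exact: ltnW.
by rewrite ltn_eqF.
Qed.

(** Dual to [closed_shrinking]: the complements of the C i form an open cover,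
and the complements of a closed shrinking of it are neighbourhoods of the C i
that have no common point either. *)
Lemma open_swelling (M : nat) (O C : nat -> set T) :
  (forall i, open (O i)) -> (forall i, closed (C i)) ->
  (forall i, C i `<=` O i) -> (forall x, ~ forall i, (i < M)%N -> C i x) ->
  exists W : nat -> set T, [/\ forall i, open (W i), forall i, C i `<=` W i,
    forall i, W i `<=` O i & forall x, ~ forall i, (i < M)%N -> W i x].
Proof.
move=> oO cC CO C0.
have oC i : open (~` C i) by rewrite openC.
have [|x _|D [cD DC covD]] := @closed_shrinking M (fun i => ~` C i) setT oC.
- exact: closedT.
- have /existsNP[i /not_implyP[iM nC]] := C0 x; by exists i.
exists (fun i => O i `&` ~` D i); split=> [i|i x Cx|i|x W].
- by apply: openI => //; rewrite openC.
- by split; [exact: CO | move=> /DC; apply].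
- exact: subIsetl.
- by have [//|i iM Dx] := covD x; have [_] := W i iM; apply.
Qed.

End Normal.

(** * Complete normality and subspaces *)

(** Unlike normality, this separation property passes to all subspaces; the sum
theorem is applied in subspaces that need not be closed. *)
Definition completely_normal (T : topologicalType) : Prop :=
  forall A B : set T, closure A `<=` ~` B -> A `<=` ~` closure B ->
  exists U V, [/\ open U, open V, A `<=` U, B `<=` V & U `<=` ~` V].

Lemma completely_normal_normal (T : topologicalType) :
  completely_normal T -> normal_space T.
Proof.
move=> cnT A cA O /(set_nbhsP A O)[C [oC AC CO]].
have [| |U [V [oU oV AU CV UV]]] := cnT A (~` C).
- by move/closure_id: cA => <- x /AC Cx /(_ Cx).
- have /closure_id <- : closed (~` C) by rewrite closedC.
  by move=> x /AC Cx /(_ Cx).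
exists U; first by apply/set_nbhsP; exists U; split.
apply: subset_trans CO => x /(nclosure_open oV UV) nVx.
by apply: contrapT => /CV.
Qed.

Section Subspace.
Variables (T : topologicalType) (D : set T).

Lemma open_preimage_val (O : set T) : open O -> open (set_val @^-1` O : set D).
Proof. by exists O. Qed.

Lemma closed_preimage_val (C : set T) :
  closed C -> closed (set_val @^-1` C : set D).
Proof.
by rewrite -openC => oC; rewrite -openC preimage_setC; exact: open_preimage_val.
Qed.

Lemma open_valE (U : set D) :
  open U -> exists2 O : set T, open O & U = set_val @^-1` O.
Proof. by case=> O oO <-; exists O. Qed.

Lemma val_in (x : D) : D (set_val x).
Proof. by case: x => x Dx; exact: set_mem Dx. Qed.

Lemma closure_val (A : set D) (x : D) :
  closure (set_val @` A) (set_val x) -> closure A x.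
Proof.
move=> clA N; rewrite nbhsE => -[W [/open_valE[O oO ->] Ox] ON].
have [|_ [[a Aa <-] Oa]] := clA O; first by apply: open_nbhs_nbhs.
by exists a; split=> //; exact: ON.
Qed.

Lemma completely_normal_sub : completely_normal T -> completely_normal D.
Proof.
move=> cnT A B AB BA.
have [| |U [V [oU oV AU BV UV]]] := cnT (set_val @` A) (set_val @` B).
- by move=> _ /[swap] -[b Bb <-] /closure_val /AB; apply.
- by move=> _ [a Aa <-] /closure_val; exact: BA.
exists (set_val @^-1` U), (set_val @^-1` V).
split; do ?exact: open_preimage_val; last by move=> x /UV.
  by move=> x Ax; apply: AU; exists x.
by move=> x Bx; apply: BV; exists x.
Qed.

End Subspace.

(** * Zero-dimensional subsets *)

(** U and V are required to be disjoint in all of T, not only on D.  In a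
completely normal space this is no restriction, by [zero_dim_val], and it lets
the sets U and V be used in T directly. *)
Definition zero_dim (T : topologicalType) (D : set T) : Prop :=
  forall O Q : set T, open O -> open Q -> D `<=` O `|` Q ->
  exists U V, [/\ open U /\ open V, U `<=` O, V `<=` Q, D `<=` U `|` V &
    U `<=` ~` V].

(** An open cover of the part of D in P becomes one of D after adding the
complement of P to one member. *)
Lemma zero_dimI_closed (T : topologicalType) (D P : set T) :
  zero_dim D -> closed P -> zero_dim (D `&` P).
Proof.
move=> zD cP O Q oO oQ DOQ.
have oO' : open (O `|` ~` P) by apply: openU => //; rewrite openC.
have [|U [V [[oU oV] UO VQ UVD UV]]] := zD _ _ oO' oQ.
  move=> x Dx; have [Px|] := pselect (P x); last by left; right.
  by have [|] := DOQ x (conj Dx Px); [left; left | right].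
exists (U `&` O), V; split => //; first by split=> //; exact: openI.
- by move=> x [Dx Px]; have [/[dup] Ux /UO[]|] := UVD x Dx; [left | | right].
- by move=> x [/UV].
Qed.

Lemma zero_dim_preimage (T : topologicalType) (D E : set T) :
  E `<=` D -> zero_dim E -> zero_dim (set_val @^-1` E : set D).
Proof.
move=> ED zE O Q /open_valE[O' oO' ->] /open_valE[Q' oQ' ->] EOQ.
have [|U [V [[oU oV] UO VQ UVE UV]]] := zE _ _ oO' oQ'.
  by move=> x Ex; exact: (EOQ (exist _ x (mem_set (ED x Ex))) Ex).
exists (set_val @^-1` U), (set_val @^-1` V); split=> [|x /UO|x /VQ|x /UVE|x /UV] //.
by split; exact: open_preimage_val.
Qed.

(** The two relatively open pieces of D are separated in T, so complete normality
gives them disjoint neighbourhoods in T. *)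
Lemma zero_dim_val (T : topologicalType) (D : set T) :
  completely_normal T -> zero_dim [set: D] -> zero_dim D.
Proof.
move=> cnT zD O Q oO oQ DOQ.
have [|U [V [[oU oV] UO VQ UVD UV]]] := zD _ _ (open_preimage_val D oO)
  (open_preimage_val D oQ).
  by move=> x _; apply: DOQ; exact: val_in.
have [| |U' [V' [oU' oV' UU VV UV']]] := cnT (set_val @` U) (set_val @` V).
- by move=> _ /[swap] -[v Vv <-] /closure_val /(nclosure_open oV UV); apply.
- move=> _ [u Uu <-] /closure_val.
  have VU : V `<=` ~` U by move=> x Vx /UV.
  by move/(nclosure_open oU VU).
exists (U' `&` O), (V' `&` Q); split; do ?exact: subIsetr.
- by split; exact: openI.
- move=> x Dx; have [] := UVD (exist _ x (mem_set Dx)) I => [Ux|Vx].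
    by left; split; [apply: UU; exists (exist _ x (mem_set Dx)) | exact: UO Ux].
  by right; split; [apply: VV; exists (exist _ x (mem_set Dx)) | exact: VQ Vx].
- by move=> x [/UV' nV _] [].
Qed.

(** A zero-dimensional set can be avoided by boundaries.  Splitting D by disjoint
U and V away from the complement of O and away from F does not yet give a
neighbourhood of F; F is not covered by U.  Adding to U a neighbourhood A of F,
cut off at the closure of V, keeps W disjoint from V, so that D, which lies in
the union of U and V, misses the boundary of W. *)
Lemma zero_dim_between (T : topologicalType) (D F O : set T) :
  normal_space T -> zero_dim D -> closed F -> open O -> F `<=` O ->
  exists W, [/\ open W, F `<=` W, closure W `<=` O & closure W `\` W `<=` ~` D].
Proof.
move=> nT zD cF oO FO.
have cO : closed (~` O) by rewrite closedC.
have FnO : F `<=` ~` ~` O by rewrite setCK.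
have [A [B [oA oB FA OB AB]]] := normal_separate nT cF cO FnO.
have oA' : open (~` closure A) by rewrite openC; exact: closed_closure.
have oB' : open (~` closure B) by rewrite openC; exact: closed_closure.
have [|U [V [[oU oV] UB VA UVD UV]]] := zD _ _ oB' oA'.
  by move=> x _; have [/AB|] := pselect (closure A x); [left | right].
have VnA : V `<=` ~` A by move=> x /VA nA /subset_closure.
exists (U `|` (A `&` ~` closure V)); split.
- apply: openU => //; apply: openI => //; rewrite openC; exact: closed_closure.
- move=> x Fx; right; split; first exact: FA.
  by move/(nclosure_open oA VnA); apply; exact: FA.
- move=> x clW; apply: contrapT => nOx.
  suff /(nclosure_open oB) : U `|` (A `&` ~` closure V) `<=` ~` B.
    by move=> /(_ _ clW); apply; exact: OB.
  move=> y [/UB nBy /subset_closure//|[/subset_closure/AB nBy _]].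
  by move=> /subset_closure.
- move=> x [clW nW] Dx; have [Ux|Vx] := UVD x Dx; first by apply: nW; left.
  suff /(nclosure_open oV) : U `|` (A `&` ~` closure V) `<=` ~` V.
    by move=> /(_ _ clW).
  by move=> y [/UV//|[_ nV] /subset_closure].
Qed.

(** * The countable sum theorem for zero-dimensional sets *)

(** Disjointness of the closures, and not only of the sets, is the invariant that
lets two growing open sets be enlarged again and again. *)
Definition separated_opens (T : topologicalType) (st : set T * set T) : Prop :=
  [/\ open st.1, open st.2 & closure st.1 `<=` ~` closure st.2].

Section CountableSum.
Variable T : topologicalType.
Hypothesis nT : normal_space T.

(** Take W around the closure of the first set with boundary off C.  Then C splits
into the closed pieces inside the closure of W and outside W; each is added to
the set on its side, and normality makes room around the results. *)
Lemma zero_dim_absorb_step (C : set T) (st : set T * set T) :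
  closed C -> zero_dim C -> separated_opens st ->
  exists st', [/\ separated_opens st', st.1 `<=` st'.1, st.2 `<=` st'.2 &
    C `<=` st'.1 `|` st'.2].
Proof.
move=> cC zC [oU oV UV].
have oV' : open (~` closure st.2) by rewrite openC; exact: closed_closure.
have [W [oW UW WV WC]] :=
  zero_dim_between nT zC (closed_closure (A := st.1)) oV' UV.
have [] := @normal_separate _ nT (closure st.1 `|` (C `&` closure W))
  (closure st.2 `|` (C `&` ~` W)).
- by apply: closedU; [|apply: closedI => //]; exact: closed_closure.
- apply: closedU; first exact: closed_closure.
  by apply: closedI => //; rewrite closedC.
- move=> x [Ux [/(UV x Ux)//|[_ nWx]]|[Cx Wx] [/(WV x Wx)//|[_ nWx]]].
    exact/nWx/UW.
  exact: (WC x).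
move=> U [V [oU1 oV1 UU VV UV1]]; exists (U, V); split=> //= x.
- by move=> /subset_closure Ux; apply: UU; left.
- by move=> /subset_closure Vx; apply: VV; left.
- move=> Cx; have [Wx|nWx] := pselect (W x).
    by left; apply: UU; right; split=> //; exact: subset_closure.
  by right; apply: VV; right.
Qed.

(** Starting from neighbourhoods of the complements of Q and O, absorb the sets
C s one after the other; the unions of the two increasing sequences are disjoint
open sets covering the space.  That the first one contains the complement of Q
forces the second one into Q, and conversely. *)
Theorem zero_dim_bigcup (C : nat -> set T) :
  (forall s, closed (C s)) -> (forall s, zero_dim (C s)) ->
  \bigcup_s C s = setT -> zero_dim [set: T].
Proof.
move=> cC zC CT O Q oO oQ OQ.
have [] := @normal_separate _ nT (~` Q) (~` O).
- by rewrite closedC.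
- by rewrite closedC.
- by move=> x nQ nO; have [] := OQ x I.
move=> U0 [V0 [oU0 oV0 QU OV UV0]].
have /choice[f fP] : forall sst : nat * (set T * set T), exists st',
    separated_opens sst.2 -> [/\ separated_opens st', sst.2.1 `<=` st'.1,
      sst.2.2 `<=` st'.2 & C sst.1 `<=` st'.1 `|` st'.2].
  move=> [s st]; have [ist|nst] := pselect (separated_opens st).
    by have [st' st'P] := zero_dim_absorb_step (cC s) (zC s) ist; exists st'.
  by exists st => /nst.
pose st := fix st s := if s is s'.+1 then f (s', st s') else (U0, V0).
have ist s : separated_opens (st s).
  by elim: s => [|s /(fP (s, _))[]].
have stS s : [/\ (st s).1 `<=` (st s.+1).1, (st s).2 `<=` (st s.+1).2 &
    C s `<=` (st s.+1).1 `|` (st s.+1).2].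
  by have [] := fP (s, st s) (ist s).
have mono s t : (s <= t)%N -> (st s).1 `<=` (st t).1 /\ (st s).2 `<=` (st t).2.
  elim: t => [|t IH]; first by rewrite leqn0 => /eqP->; split.
  rewrite leq_eqVlt => /predU1P[->|/IH[U1 V1]]; first by split.
  have [U2 V2 _] := stS t.
  by split; [apply: subset_trans U1 U2 | apply: subset_trans V1 V2].
have disj s t : (st s).1 `<=` ~` (st t).2.
  move=> x Ux Vx; have [_ _ /(_ x)] := ist (maxn s t).
  apply; apply: subset_closure.
    exact: (mono _ _ (leq_maxl s t)).1.
  exact: (mono _ _ (leq_maxr s t)).2.
exists (\bigcup_s (st s).1), (\bigcup_s (st s).2); split.
- by split; apply: bigcup_open => s _; have [] := ist s.
- move=> x [s _ Ux]; apply: contrapT => nOx.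
  by apply: (disj s 0%N x Ux); exact: OV.
- move=> x [s _ Vx]; apply: contrapT => nQx.
  by apply: (disj 0%N s x _ Vx); exact: QU.
- move=> x _; have [s _ Csx] : (\bigcup_s C s) x by rewrite CT.
  by have [_ _ /(_ x Csx)[]] := stS s; [left | right]; exists s.+1.
- by move=> x [s _ Ux] [t _]; exact: disj Ux.
Qed.

End CountableSum.

(** The sum theorem applies in the subspace D, which is normal because T is
completely normal. *)
Lemma zero_dim_bigcup_rel (T : topologicalType) (D : set T) (M : nat -> set T) :
  completely_normal T -> (forall s, closed (M s)) ->
  (forall s, zero_dim (D `&` M s)) -> D `<=` \bigcup_s M s -> zero_dim D.
Proof.
move=> cnT cM zM DM; apply: zero_dim_val => //.
apply: (zero_dim_bigcup _ (C := fun s => set_val @^-1` M s)) => [|s|s|].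
- exact/completely_normal_normal/completely_normal_sub.
- exact: closed_preimage_val.
- rewrite (_ : _ @^-1` _ = set_val @^-1` (D `&` M s)).
    by apply: zero_dim_preimage => //; exact: subIsetl.
  by apply/seteqP; split=> x /= => [Mx|[]//]; split=> //; exact: val_in.
- apply/seteqP; split=> // x _; have [s _ Ms] := DM _ (val_in x).
  by exists s.
Qed.

(** * Partitions of sequences of pairs of closed sets *)

Section Partitions.
Variable T : topologicalType.
Hypothesis nT : normal_space T.

Lemma closed_shrinking_ord (p : nat) (V : 'I_p -> set T) : open_cover V ->
  exists F : 'I_p -> set T, [/\ forall j, closed (F j),
    forall j, F j `<=` V j & forall x, exists j, F j x].
Proof.
move=> [oV VT].
pose O i := \bigcup_(j in [set j : 'I_p | nat_of_ord j = i]) V j.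
have oO i : open (O i) by apply: bigcup_open.
have [|x _|C [cC CO covC]] := @closed_shrinking _ nT p O setT oO.
- exact: closedT.
- have [j _ Vj] : (\bigcup_j V j) x by rewrite VT.
  by exists j => //; exists j.
exists (fun j => C j); split=> [//|j x /CO[j' /= /val_inj ->]//|x].
by have [//|i ip Ci] := covC x; exists (Ordinal ip).
Qed.

(** As each closure lies in the next set, a point is on the boundary of at most
one W i. *)
Lemma normal_nested (F O : set T) : closed F -> open O -> F `<=` O ->
  exists W : nat -> set T, [/\ forall i, open (W i), forall i, F `<=` W i,
    forall i, closure (W i) `<=` O &
    forall i i', (i < i')%N -> closure (W i) `<=` W i'].
Proof.
move=> cF oO FO.
have /choice[f fP] : forall G : set T, exists W : set T,
    closed G -> G `<=` O -> [/\ open W, G `<=` W & closure W `<=` O].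
  move=> G; have [cG|] := pselect (closed G); last by exists set0.
  have [GO|] := pselect (G `<=` O); last by exists set0.
  by have [W] := normal_between nT cG oO GO; exists W.
pose W := fix W i := if i is i'.+1 then f (closure (W i')) else f F.
have WP i : open (W i) /\ closure (W i) `<=` O.
  elim: i => [|i [_ IH]] /=; first by have [] := fP F cF FO.
  by have [] := fP _ (closed_closure (A := W i)) IH.
have WS i : closure (W i) `<=` W i.+1.
  by have [] := fP _ (closed_closure (A := W i)) (WP i).2.
have Wlt i i' : (i < i')%N -> closure (W i) `<=` W i'.
  elim: i' => // i' IH; rewrite ltnS leq_eqVlt => /predU1P[->|/IH ii'].
    exact: WS.
  by apply: subset_trans ii' _ => x /subset_closure /WS.
exists W; split=> [i|[|i]|i|//]; [exact: (WP i).1| | |exact: (WP i).2].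
  by have [] := fP F cF FO.
have [_ FW _] := fP F cF FO.
by move=> x /FW Wx; apply: (Wlt 0%N) => //; exact: subset_closure.
Qed.

(** Refine the cover by the sets that choose, for each i in S, to avoid A i or
B i; let V be such a refinement of order N, F a closed shrinking of it and W j i
nested neighbourhoods of F j inside V j.  The partition for i is the boundary
of the union of the W j i over the members V j that meet A i.  A point on the boundaries
for all N + 1 indices i lies on the boundary of W j i for some j depending on i,
and the j are distinct because for fixed j the boundaries are disjoint.  It also
lies in some F j, and this j is different again, as F j is inside every W j i.
So the point is in N + 2 members of V, which the order forbids. *)
Lemma partitions_of_covdim (N : nat) (A B : nat -> set T) (S : seq nat) :
  covdim_le T N -> (forall i, closed (A i)) -> (forall i, closed (B i)) ->
  (forall i, A i `<=` ~` B i) -> uniq S -> size S = N.+1 ->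
  exists U V : nat -> set T, [/\ forall i, open (U i) /\ open (V i),
    forall i, A i `<=` U i, forall i, i \in S -> B i `<=` V i,
    forall i, U i `<=` ~` V i & forall x, exists2 i, i \in S & (U i `|` V i) x].
Proof.
move=> dimT cA cB AB uS sS.
pose sigma := {ffun 'I_N.+1 -> bool}.
pose O (s : sigma) :=
  \bigcap_t (if s t then ~` A (nth 0%N S t) else ~` B (nth 0%N S t)).
have [|p [V [cV VO Vord]]] := dimT #|{: sigma}| (fun l => O (enum_val l)).
  split=> [l|].
    apply: open_bigcap_fin => [|t _]; first exact: finite_finset.
    by case: ifP => _; rewrite openC.
  apply/seteqP; split=> // x _.
  pose s : sigma := [ffun t : 'I_N.+1 => `[< ~ A (nth 0%N S t) x >]].
  exists (enum_rank s) => //; rewrite enum_rankK => t _.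
  rewrite ffunE; case: asboolP => [//|/contrapT /AB]; exact.
pose meets i := [set j | V j `&` A i !=set0].
have meetsB i j : i \in S -> meets i j -> V j `<=` ~` B i.
  move=> iS [y [Vy Ay]]; have [l VOl] := VO j.
  have iN : (index i S < N.+1)%N by rewrite -sS index_mem.
  move=> x /VOl /(_ (Ordinal iN) I) /=; have := VOl y Vy (Ordinal iN) I.
  by rewrite /= nth_index //; case: ifP => // _ /(_ Ay).
have [F [cF FV covF]] := closed_shrinking_ord cV.
have /choice[W WP] j := normal_nested (cF j) (cV.1 j) (FV j).
pose U i := \bigcup_(j in meets i) W j i.
have oU i : open (U i).
  by apply: bigcup_open => j _; have [] := WP j.
have clU i x : closure (U i) x -> exists2 j, meets i j & closure (W j i) x.
  have UC : U i `<=` \bigcup_(j in meets i) closure (W j i).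
    by move=> y [j mj Wy]; exists j => //; exact: subset_closure.
  move=> /(closureS UC); rewrite -(closure_id _).1; first by [].
  apply: closed_bigcup => [|j _]; first exact: finite_finset.
  exact: closed_closure.
exists U, (fun i => ~` closure (U i)); split=> [i|i x Ax|i iS x Bx|i x Ux|x].
- by split=> //; rewrite openC; exact: closed_closure.
- have [j Fx] := covF x; have [_ FW _ _] := WP j.
  by exists j; [exists x; split=> //; exact: FV | exact: FW].
- move=> /clU[j mj]; have [_ _ WV _] := WP j.
  by move=> /WV /(meetsB i j iS mj); apply.
- by apply; exact: subset_closure.
apply: contrapT => nU.
have [j0 Fx] := covF x.
have /choice[l lP] : forall i, exists j, i \in S ->
    [/\ meets i j, closure (W j i) x & ~ W j i x].
  move=> i; have [iS|] := boolP (i \in S); last by exists j0.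
  have /clU[j mj Wx] : closure (U i) x.
    by apply: contrapT => nUx; apply: nU; exists i => //; right.
  exists j => _; split=> // Wjx; apply: nU; exists i => //; left.
  by exists j.
(* The members V j0 and V (l i), for i in S, are the N + 2 forbidden ones. *)
have := Vord x; rewrite leqNgt => /negP; apply.
have <- : size (j0 :: map l S) = N.+2 by rewrite /= size_map sS.
rewrite cardE; apply: uniq_leq_size => [|j].
  rewrite cons_uniq map_inj_in_uniq ?uS ?andbT.
    apply/negP => /mapP[i iS j0E]; have [_ _] := lP i iS; apply.
    by rewrite -j0E; have [_ FW _ _] := WP j0; exact: FW.
  move=> i i' iS i'S ll'; have [_ Wi nWi] := lP i iS.
  have [_ Wi' nWi'] := lP i' i'S; have [_ _ _ Wlt] := WP (l i).
  have [ii'|i'i|//] := ltngtP i i'.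
    by case: nWi'; rewrite -ll'; exact: (Wlt i).
  by case: nWi; apply: (Wlt i') => //; rewrite ll'.
move=> jS; suff Vj : V j x by rewrite mem_enum inE.
move: jS; rewrite inE => /predU1P[->|/mapP[i iS ->]]; first exact: FV.
by have [_ Wx _] := lP i iS; have [_ _ WV _] := WP (l i); exact: WV Wx.
Qed.

(** [partitions_of_covdim] gives disjoint open sets, and a later step would have
no room to enlarge them.  A closed shrinking of the cover that they form restores
disjoint closures. *)
Lemma partitions_step (N : nat) (st : nat -> set T * set T) (S : seq nat) :
  covdim_le T N -> (forall i, separated_opens (st i)) ->
  uniq S -> size S = N.+1 ->
  exists st' : nat -> set T * set T, [/\ forall i, separated_opens (st' i),
    forall i, (st i).1 `<=` (st' i).1, forall i, (st i).2 `<=` (st' i).2 &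
    forall x, exists2 i, i \in S & ((st' i).1 `|` (st' i).2) x].
Proof.
move=> dimT ist uS sS.
have [i|i|i|U [V [oUV AU BV UV covUV]]] := @partitions_of_covdim N
  (fun i => closure (st i).1) (fun i => closure (st i).2) S dimT _ _ _ uS sS.
- exact: closed_closure.
- exact: closed_closure.
- by have [] := ist i.
have [||x _|C [cC CUV covC]] := @closed_shrinking _ nT N.+1
  (fun t => U (nth 0%N S t) `|` V (nth 0%N S t)) setT.
- by move=> t; have [? ?] := oUV (nth 0%N S t); apply: openU.
- exact: closedT.
- have [i iS UVx] := covUV x; exists (index i S); first by rewrite -sS index_mem.
  by rewrite nth_index.
have /choice[st' st'P] : forall i, exists st' : set T * set T,
    [/\ separated_opens st', (st i).1 `<=` st'.1, (st i).2 `<=` st'.2 &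
      i \in S -> C (index i S) `<=` st'.1 `|` st'.2].
  move=> i; have [iS|] := boolP (i \in S); last by exists (st i); split.
  have [oU oV] := oUV i; pose D := C (index i S).
  have DUV : D `<=` U i `|` V i by move=> x /CUV; rewrite nth_index.
  have [|||P [Q [oP oQ UP VQ PQ]]] := @normal_separate _ nT
    (closure (st i).1 `|` (D `&` ~` V i)) (closure (st i).2 `|` (D `&` ~` U i)).
  - apply: closedU; first exact: closed_closure.
    by apply: closedI; [exact: cC | rewrite closedC].
  - apply: closedU; first exact: closed_closure.
    by apply: closedI; [exact: cC | rewrite closedC].
  - move=> x [Ux|[Dx nVx]] [Vx|[Dx' nUx]].
    + by have [_ _ /(_ x Ux)] := ist i; apply.
    + by apply: nUx; exact: AU.
    + by apply: nVx; exact: BV.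
    + by have [] := DUV x Dx.
  exists (P, Q); split=> //= [x Ux|x Vx|_ x Dx].
  - by apply: UP; left; exact: subset_closure.
  - by apply: VQ; left; exact: subset_closure.
  - have [Ux|nUx] := pselect (U i x).
      by left; apply: UP; right; split=> //; exact: UV.
    by right; apply: VQ; right.
exists st'; split=> [i|i|i|x]; do ?by have [] := st'P i.
have [//|t tN Cx] := covC x.
have tS : (t < size S)%N by rewrite sS.
exists (nth 0%N S t); first exact: mem_nth.
by have [_ _ _] := st'P (nth 0%N S t); apply; rewrite ?mem_nth ?index_uniq.
Qed.

(** There are countably many finite sets S of indices.  Going through all of them
and enlarging the pairs by [partitions_step] each time, one gets increasing
open sets; the increasing unions satisfy the covering condition for every S, since
it was achieved at one step and is kept afterwards. *)
Theorem partitions_sequence (N : nat) (A B : nat -> set T) :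
  covdim_le T N -> (forall i, closed (A i)) -> (forall i, closed (B i)) ->
  (forall i, A i `<=` ~` B i) ->
  exists U V : nat -> set T, [/\ forall i, open (U i) /\ open (V i),
    forall i, A i `<=` U i, forall i, B i `<=` V i,
    forall i, U i `<=` ~` V i &
    forall S, uniq S -> size S = N.+1 ->
      forall x, exists2 i, i \in S & (U i `|` V i) x].
Proof.
move=> dimT cA cB AB.
have /choice[st0 st0P] : forall i, exists st : set T * set T,
    [/\ separated_opens st, A i `<=` st.1 & B i `<=` st.2].
  move=> i; have [U [V [? ? ? ? ?]]] := normal_separate nT (cA i) (cB i) (AB i).
  by exists (U, V).
have /choice[f fP] : forall Sst : seq nat * (nat -> set T * set T), exists st',
    (forall i, separated_opens (Sst.2 i)) ->
    [/\ forall i, separated_opens (st' i), forall i, (Sst.2 i).1 `<=` (st' i).1,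
      forall i, (Sst.2 i).2 `<=` (st' i).2 & uniq Sst.1 -> size Sst.1 = N.+1 ->
      forall x, exists2 i, i \in Sst.1 & ((st' i).1 `|` (st' i).2) x].
  move=> [S st] /=; have [[uS sS]|nS] := pselect (uniq S /\ size S = N.+1).
    have [ist|] := pselect (forall i, separated_opens (st i)); last by exists st.
    by have [st' [? ? ? ?]] := partitions_step dimT ist uS sS; exists st'.
  by exists st => ist; split=> [|i x|i x|uS sS] //; case: nS.
pose st := fix st s := if s is s'.+1
  then f (odflt [::] (unpickle s'), st s') else st0.
have ist s : forall i, separated_opens (st s i).
  elim: s => [i|s IH]; first by have [] := st0P i.
  by have [] := fP (odflt [::] (unpickle s), st s) IH.
have mono s t i : (s <= t)%N ->
    (st s i).1 `<=` (st t i).1 /\ (st s i).2 `<=` (st t i).2.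
  elim: t => [|t IH]; first by rewrite leqn0 => /eqP->; split.
  rewrite leq_eqVlt => /predU1P[->|/IH[U1 V1]]; first by split.
  have [_ U2 V2 _] := fP (odflt [::] (unpickle t), st t) (ist t).
  by split; [apply: subset_trans U1 (U2 i) | apply: subset_trans V1 (V2 i)].
exists (fun i => \bigcup_s (st s i).1), (fun i => \bigcup_s (st s i).2).
split=> [i|i x Ax|i x Bx|i x [s _ Ux] [t _ Vx]|S uS sS x].
- by split; apply: bigcup_open => s _; have [] := ist s i.
- by exists 0%N => //; have [_ + _] := st0P i; exact.
- by exists 0%N => //; have [_ _ +] := st0P i; exact.
- have [_ _ /(_ x)] := ist (maxn s t) i; apply; apply: subset_closure.
    exact: (mono _ _ i (leq_maxl s t)).1.
  exact: (mono _ _ i (leq_maxr s t)).2.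
- have stE : st (pickle S).+1 =
    f (odflt [::] (unpickle (pickle S)), st (pickle S)) by [].
  rewrite pickleK in stE.
  have [_ _ _ /(_ uS sS x)[i iS UV]] := fP (S, st (pickle S)) (ist _).
  exists i => //; rewrite -stE in UV.
  by case: UV => ?; [left|right]; exists (pickle S).+1.
Qed.

End Partitions.

(** * A criterion for zero-dimensionality *)

Lemma zero_dim0 (T : topologicalType) : zero_dim (set0 : set T).
Proof.
by move=> O Q _ _ _; exists set0, set0; split=> //; split; exact: open0.
Qed.

Lemma open_local (T : topologicalType) (E : set T) :
  (forall z, E z -> exists N, [/\ open N, N z & N `<=` E]) -> open E.
Proof.
move=> locE; rewrite openE => z /locE[N [oN Nz NE]].
by apply: filterS NE _; exact: open_nbhs_nbhs.
Qed.

(** The sets U i and V i are relatively clopen on D, with complements U' i and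
V' i.  Each point of D is assigned to O or Q by the first i for which it is in U i
or V i, with preference for U i. *)
Lemma disjoint_refinement (T : topologicalType) (D O Q : set T)
    (U U' V V' : nat -> set T) :
  (forall i, open (U i) /\ open (U' i)) ->
  (forall i, open (V i) /\ open (V' i)) ->
  (forall i, U i `<=` O) -> (forall i, V i `<=` Q) ->
  (forall i, U i `<=` ~` U' i) -> (forall i, V i `<=` ~` V' i) ->
  (forall i, D `<=` U i `|` U' i) -> (forall i, D `<=` V i `|` V' i) ->
  (forall x, D x -> exists i, (U i `|` V i) x) ->
  exists P W, [/\ open P /\ open W, P `<=` O, W `<=` Q, D `<=` P `|` W &
    P `<=` ~` W].
Proof.
move=> oU oV UO VQ UU' VV' DU DV DUV.
pose P i := U i `&` \bigcap_(j in `I_i) V' j.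
pose W i := V i `&` \bigcap_(j in `I_i) U' j.
have fin i : finite_set `I_i by exact: finite_II.
exists (\bigcup_i (P i)), (\bigcup_i (W i `&` U' i)); split.
- split; apply: bigcup_open => i _.
    apply: openI; first exact: (oU i).1.
    by apply: open_bigcap_fin => // j _; exact: (oV j).2.
  apply: openI; last exact: (oU i).2.
  apply: openI; first exact: (oV i).1.
  by apply: open_bigcap_fin => // j _; exact: (oU j).2.
- by move=> x [i _ [/UO]].
- by move=> x [i _ [[/VQ]]].
- move=> x Dx; have exUV : exists i, `[< (U i `|` V i) x >].
    by have [i UVi] := DUV x Dx; exists i; exact/asboolP.
  case: (ex_minnP exUV) => i /asboolP UVi imin.
  have lt_not j : (j < i)%N -> ~ (U j `|` V j) x.
    by move=> ji /asboolP /imin; rewrite leqNgt ji.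
  have [Ui|nUi] := pselect (U i x).
    left; exists i => //; split=> // j /= ji.
    by have [Vj|//] := DV j x Dx; have := lt_not j ji; case; right.
  right; exists i => //; split; last by have [|] := DU i x Dx.
  split; first by case: UVi.
  move=> j /= ji.
  by have [Uj|//] := DU j x Dx; have := lt_not j ji; case; left.
- move=> x [i _ [Ui Vi]] [j _ [[Vj Uj] Uj']].
  have [ij|ji] := leqP i j; last exact: (VV' j x Vj (Vi j ji)).
  move: ij; rewrite leq_eqVlt => /predU1P[ij|ij].
    by apply: (UU' i x Ui); rewrite ij.
  exact: (UU' i x Ui (Uj i ij)).
Qed.

(** A labelling [l p] that is locally constant on an open set [G p] encodes a
family of disjoint open sets, its fibers, whose union is [G p]. *)
Section Labels.
Variables (T : topologicalType) (G : nat -> set T) (l : nat -> T -> T).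
Hypothesis lG : forall p z, G p z -> exists N, [/\ open N, N z &
  forall z', N z' -> G p z' /\ l p z' = l p z].

(** If U i and V i cover D, their partition misses D, so the intersections of U i
with the fibers of [l i] are relatively clopen in D.  This holds also for the
union E H i of those of them whose fiber lies in a given set H, because the fibers
are disjoint and open.  When these pieces contain arbitrarily small
neighbourhoods of the points of D, [disjoint_refinement] applies. *)
Lemma zero_dim_of_labels (D : set T) (J : set nat) (U V : nat -> set T) :
  (forall i, open (U i) /\ open (V i)) -> (forall i, U i `<=` ~` V i) ->
  (forall i, ~` G i `<=` V i) -> (forall i, J i -> D `<=` U i `|` V i) ->
  (forall y O, D y -> open O -> O y -> exists i, [/\ J i, U i y &
     forall z, G i z -> l i z = l i y -> O z]) ->
  zero_dim D.
Proof.
move=> oUV UV GV DUV base O Q oO oQ DOQ.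
have UG i : U i `<=` G i by move=> z Uz; apply: contrapT => /GV; exact: UV.
pose E H i := [set z | [/\ J i, U i z &
  forall z', G i z' -> l i z' = l i z -> H z']].
pose E' H i := [set z | J i -> (U i `|` V i) z /\ ~ E H i z].
have EO H i : E H i `<=` H by move=> z [_ /UG Gz]; exact.
have EE' H i : E H i `<=` ~` E' H i.
  by move=> z Ez; case: (Ez) => Ji _ _ /(_ Ji)[].
have DE H i : D `<=` E H i `|` E' H i.
  move=> z Dz; have [|nE] := pselect (E H i z); [by left | right].
  by move=> Ji; split=> //; exact: DUV.
have oE H i : open (E H i) /\ open (E' H i).
  split; apply: open_local => z.
    move=> [Ji Uz HE]; have [N [oN Nz NG]] := lG (UG i z Uz).
    exists (N `&` U i); split=> // [|z' [/NG[_ lz'] Uz']].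
      by apply: openI => //; exact: (oUV i).1.
    by split=> // z'' Gz''; rewrite lz'; exact: HE.
  move=> E'z; have [Ji|nJi] := pselect (J i); last first.
    by exists setT; split=> //; exact: openT.
  have [[Uz|Vz] nEz] := E'z Ji; last first.
    exists (V i); split=> //; first exact: (oUV i).2.
    by move=> z' Vz' _; split; [right | move=> [_ /UV]].
  have [N [oN Nz NG]] := lG (UG i z Uz).
  exists (N `&` U i); split=> // [|z' [/NG[_ lz'] Uz'] _].
    by apply: openI => //; exact: (oUV i).1.
  split; first by left.
  by move=> [_ _ HE]; apply: nEz; split=> // z''; rewrite -lz'; exact: HE.
apply: (@disjoint_refinement _ D O Q (E O) (E' O) (E Q) (E' Q)) => //.
move=> y Dy; have [Oy|Qy] := DOQ y Dy.
  by have [i [Ji Uy HO]] := base y O Dy oO Oy; exists i; left.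
by have [i [Ji Uy HQ]] := base y Q Dy oQ Qy; exists i; right.
Qed.

End Labels.

(** * Metric spaces *)

Section PseudoMetric.
Local Open Scope ring_scope.
Import Order.TTheory GRing.Theory Num.Theory.
Variables (R : realFieldType) (X : pseudoMetricType R).

Lemma radius_away (A B : set X) : A `<=` ~` closure B ->
  exists2 r : X -> R, forall a, 0 < r a & forall a, A a -> ball a (r a) `<=` ~` B.
Proof.
move=> AB.
have /choice[r rP] : forall a, exists r : R,
    0 < r /\ (A a -> ball a r `<=` ~` B).
  move=> a; have [Aa|] := pselect (A a); last by exists 1; split; first exact: ltr01.
  have : nbhs a (~` closure B).
    apply: open_nbhs_nbhs; split; last exact: AB.
    by rewrite openC; exact: closed_closure.
  move=> /nbhs_ballP[r /= r0 rB]; exists r; split=> // _ x /rB nB /subset_closure.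
  by [].
by exists r => a; have [] := rP a.
Qed.

(** Balls of half the distance to the other set cannot meet. *)
Lemma pseudometric_completely_normal : completely_normal X.
Proof.
move=> A B AB BA.
have [r r0 rB] := radius_away BA.
have [|q q0 qA] := @radius_away B A; first by move=> x Bx /AB.
pose N s (S : set X) := \bigcup_(a in S) (ball a (s a / 2))°.
have oN s S : open (N s S) by apply: bigcup_open => a _; exact: open_interior.
have SN s S : (forall a, 0 < s a) -> S `<=` N s S.
  move=> s0 a Sa; exists a => //; apply: nbhsx_ballx.
  by rewrite divr_gt0.
exists (N r A), (N q B); split; [exact: oN|exact: oN|exact: SN|exact: SN|].
move=> x [a Aa /interior_subset ax] [b Bb /interior_subset bx].
have ab := ball_triangle ax (ball_sym bx).
have [qr|rq] := leP (q b) (r a).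
  apply: (rB a Aa b _ Bb); apply: le_ball ab.
  by rewrite [leRHS]splitr lerD2l ler_pM2r ?invr_gt0.
apply: (qA b Bb a _ Aa); apply: le_ball (ball_sym ab).
by rewrite [leRHS]splitr lerD2r ler_pM2r ?invr_gt0 // ltW.
Qed.

End PseudoMetric.

Section Stone.
Local Open Scope ring_scope.
Import Order.TTheory GRing.Theory Num.Theory.
Variables (R : realType) (X : pseudoMetricType R).

Lemma small_natSinv (r : R) : 0 < r -> exists n : nat, n.+1%:R^-1 < r.
Proof.
move=> r0; exists (Num.bound r^-1).
rewrite -[ltRHS]invrK ltf_pV2 ?posrE ?invr_gt0//.
have r'0 : 0 <= r^-1 by rewrite invr_ge0 ltW.
by apply: lt_le_trans (archi_boundP r'0) _; rewrite ler_nat.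
Qed.

(** Stone's choice of centers: well-order the space and let c y be the first
point that is e-close to y.  If y and y' are each close to the center of the
other, both centers are the first point close to both. *)
Lemma least_center (e : R) : 0 < e -> exists c : X -> X,
  (forall y, (ball (c y) e)° y) /\
  forall y y', (ball (c y) e)° y' -> (ball (c y') e)° y -> c y = c y'.
Proof.
move=> e0; have [W Wwo] := well_ordering_principle X.
have near_self (y : X) : (ball y e)° y by exact: nbhsx_ballx.
pose N y : {pred X} := fun x => `[< (ball x e)° y >].
have /choice[c cP] : forall y, exists z, minimum_of W (N y) z.
  move=> y; have [|z [zP _]] := Wwo (N y); last by exists z.
  by exists y; exact/asboolP.
exists c; split=> [y|y y' yy' y'y].
  by have [/asboolP] := cP y.
have [|z [_ zu]] := Wwo (fun x => N y x && N y' x).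
  by exists (c y); apply/andP; split; [have [] := cP y | exact/asboolP].
have [cy cymin] := cP y; have [cy' cymin'] := cP y'.
transitivity z; [apply/esym/zu | apply/zu]; split.
- by apply/andP; split=> //; exact/asboolP.
- by move=> x /andP[xN _]; exact: cymin.
- by apply/andP; split=> //; exact/asboolP.
- by move=> x /andP[_ xN]; exact: cymin'.
Qed.

(** A. H. Stone's theorem that metric spaces have a sigma-discrete base.  For a
radius e n, the points y that are deeper than 2 e m inside the ball of their center
form a set C n m, and points of C n m that are less than 2 e m apart have the same
center by [least_center].  Hence the e m-neighbourhood of C n m falls into disjoint
open pieces, one for each center, of size at most 2 e n; the label of a point of it
is this center.  Every point is in C n m for large m. *)
Theorem labelled_base : exists (A G : nat -> set X) (l : nat -> X -> X),
  [/\ forall p, closed (A p), forall p, open (G p), forall p, A p `<=` G p,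
    forall p z, G p z -> exists N, [/\ open N, N z &
      forall z', N z' -> G p z' /\ l p z' = l p z] &
    forall y O, open O -> O y -> exists2 p, A p y &
      forall z, G p z -> l p z = l p y -> O z].
Proof.
pose e n : R := n.+1%:R^-1.
have e0 n : 0 < e n by rewrite invr_gt0.
have /choice[c cP] n := least_center (e0 n).
pose C n m := [set y | ball y (e m + e m) `<=` (ball (c n y) (e n))°].
pose G n m := \bigcup_(y in C n m) (ball y (e m))°.
have cE n m y y' z : C n m y -> C n m y' -> ball y (e m) z ->
    ball y' (e m) z -> c n y = c n y'.
  move=> Cy Cy' yz y'z; have [_ cu] := cP n.
  apply: cu; [apply: Cy | apply: Cy'].
    exact: ball_triangle yz (ball_sym y'z).
  exact: ball_triangle y'z (ball_sym yz).
have /choice[l lP] : forall nmz : (nat * nat) * X, exists w, forall y,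
    C nmz.1.1 nmz.1.2 y -> ball y (e nmz.1.2) nmz.2 -> w = c nmz.1.1 y.
  move=> [[n m] z] /=.
  have [[y [Cy yz]]|nex] := pselect (exists y, C n m y /\ ball y (e m) z).
    by exists (c n y) => y' Cy' y'z; exact: cE yz y'z.
  by exists z => y Cy yz; case: nex; exists y.
pose nm p : nat * nat := odflt (0%N, 0%N) (unpickle p).
exists (fun p => closure (C (nm p).1 (nm p).2)), (fun p => G (nm p).1 (nm p).2).
exists (fun p z => l (nm p, z)); split=> [p|p|p z|p z|y O oO Oy].
- exact: closed_closure.
- by apply: bigcup_open => y _; exact: open_interior.
- case: (nm p) => n m /= clz; have em2 : 0 < e m / 2 by rewrite divr_gt0.
  have [y [Cy zy]] := clz _ (nbhsx_ballx z _ em2).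
  exists y => //; apply: filterS (nbhsx_ballx z _ em2) => x zx.
  by rewrite [e m]splitr; exact: ball_triangle (ball_sym zy) zx.
- case: (nm p) => n m /= [y Cy yz]; exists (ball y (e m))°.
  split=> // [|z' yz']; first exact: open_interior.
  split; first by exists y.
  rewrite (lP (n, m, z) y) /= ?(lP (n, m, z') y) //; exact: interior_subset.
have [r /= r0 rO] : exists2 r : R, 0 < r & ball y r `<=` O.
  by apply/nbhs_ballP; exact: open_nbhs_nbhs.
have [n nr] := @small_natSinv (r / 2) ltac:(by rewrite divr_gt0).
have [cy _] := cP n; have oc : open (ball (c n y) (e n))° by exact: open_interior.
have [q /= q0 qc] : exists2 q : R, 0 < q & ball y q `<=` (ball (c n y) (e n))°.
  by apply/nbhs_ballP; exact: open_nbhs_nbhs.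
have [m mq] := @small_natSinv (q / 2) ltac:(by rewrite divr_gt0).
have Cy : C n m y.
  apply: subset_trans qc; apply: le_ball.
  by rewrite [leRHS]splitr; apply: lerD; exact: ltW.
exists (pickle (n, m)); rewrite /nm pickleK /=; first exact: subset_closure.
move=> z [y' Cy' y'z]; have y'z' := interior_subset y'z.
rewrite (lP (n, m, z) y') //= (lP (n, m, y) y) //=; last exact: ballxx.
move=> cc; apply: rO.
have cz : ball (c n y) (e n) z.
  rewrite -cc; apply: interior_subset; apply: Cy'; apply: le_ball y'z'.
  by rewrite lerDl ltW.
apply: le_ball (ball_triangle (ball_sym (interior_subset (cy y))) cz).
by rewrite [leRHS]splitr; apply: lerD; exact: ltW.
Qed.

End Stone.

(** * Decomposition into zero-dimensional sets *)

Lemma injective_escapes (f : nat -> nat) (S : seq nat) :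
  injective f -> exists r, f r \notin S.
Proof.
move=> finj; apply: contrapT => nex.
have fS r : f r \in S by apply: contrapT => /negP nS; apply: nex; exists r.
have fsub : {subset map f (iota 0 (size S).+1) <= S} by move=> x /mapP[r _ ->].
have funiq : uniq (map f (iota 0 (size S).+1)) by rewrite map_inj_uniq ?iota_uniq.
by have := uniq_leq_size funiq fsub; rewrite size_map size_iota ltnn.
Qed.

(** A maximal list of elements of L contains them all. *)
Lemma finite_list_exact (L : nat -> Prop) (N : nat) :
  (forall S, uniq S -> size S = N.+1 -> ~ forall i, i \in S -> L i) ->
  exists S, [/\ uniq S, (size S <= N)%N & forall i, L i <-> i \in S].
Proof.
move=> LN.
pose P s := `[< exists S, [/\ uniq S, size S = s & forall i, i \in S -> L i] >].
have exP : exists s, P s by exists 0%N; apply/asboolP; exists [::].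
have leP s : P s -> (s <= N)%N.
  move=> /asboolP[S [uS sS SL]]; rewrite leqNgt; apply/negP => Ns.
  apply: (LN (take N.+1 S)); first exact: take_uniq.
    by rewrite size_takel // sS.
  by move=> i /mem_take; exact: SL.
case: (ex_maxnP exP leP) => s /[dup] Ps /asboolP[S [uS sS SL]] smax.
exists S; split=> // [|i]; first by rewrite sS; exact: leP.
split=> [Li|/SL//]; apply: contrapT => /negP iS.
suff /smax : P s.+1 by rewrite ltnn.
apply/asboolP; exists (i :: S); split=> [||i']; rewrite /= ?iS ?sS //.
by rewrite inE => /predU1P[->|/SL].
Qed.

(** D j consists of the points lying on exactly j of the partitions L i.  It is
the union over lists S of length j of the relatively closed sets of points of D j
that lie on all L i with i in S.  These points lie on no other L i, so the other
partitions provide neighbourhoods with boundaries off that piece.  The others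
still bound a base: every member of the labelled base is treated under infinitely
many indices i, hence under some i outside S. *)
Theorem zero_dim_decomposition (R : realType) (X : pseudoMetricType R) (N : nat) :
  covdim_le X N -> exists D : nat -> set X,
    (forall j, zero_dim (D j)) /\ forall x, exists2 j, (j <= N)%N & D j x.
Proof.
move=> dimX.
have cnX := @pseudometric_completely_normal R X.
have nX := completely_normal_normal cnX.
have [A [G [l [cA oG AG lG base]]]] := labelled_base X.
(* The index i stands for the pair (q, r), where r only serves as a counter. *)
pose p i : nat := (odflt (0%N, 0%N) (unpickle i : option (nat * nat))).1.
have [i|i|i x|U [V [oUV AU GV UV cover]]] := @partitions_sequence X nX N
  (fun i => A (p i)) (fun i => ~` G (p i)) dimX.
- exact: cA.
- by rewrite closedC.
- by move/AG => Gx; apply.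
pose L i := ~` (U i `|` V i).
have cL i : closed (L i).
  by rewrite closedC; have [? ?] := oUV i; exact: openU.
pose D j := [set x | exists S : seq nat,
  [/\ uniq S, size S = j & forall i, L i x <-> i \in S]].
exists D; split=> [j|x]; last first.
  have [|S [uS sS SL]] := @finite_list_exact (fun i => L i x) N.
    by move=> S uS sS SL; have [i /SL] := cover S uS sS x.
  by exists (size S) => //; exists S.
pose good (S : seq nat) := uniq S && (size S == j).
(* The pieces of D j, enumerated by the codes of the lists S. *)
pose M s := if unpickle s is Some t then
  if good t then \bigcap_(i in [set i | i \in t]) L i else set0 else set0.
apply: (zero_dim_bigcup_rel (M := M)) => // [s|s|x [S [uS sS SL]]].
- rewrite /M; case: unpickle => [S|]; last exact: closed0.
  by case: ifP => _; [apply: closed_bigI => i _; exact: cL | exact: closed0].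
- rewrite /M; case: unpickle => [S|]; last by rewrite setI0; exact: zero_dim0.
  case: ifP => [/andP[uS /eqP sS]|_]; last by rewrite setI0; exact: zero_dim0.
  have exact_S x : D j x -> (\bigcap_(i in [set i | i \in S]) L i) x ->
      forall i, i \notin S -> ~ L i x.
    move=> [S' [uS' sS' S'L]] SL i /negP iS /S'L iS'; apply: iS.
    have SS' : {subset S <= S'} by move=> i' i'S; apply/S'L; exact: SL.
    by have [_ ->] := uniq_min_size uS SS' ltac:(by rewrite sS sS').
  apply: (@zero_dim_of_labels X (fun i => G (p i)) (fun i => l (p i)) _ _
    [set i | i \notin S] U V) => // [i z Gz|i nS x [Dx Sx]|y O [Dy Sy] oO Oy].
  + exact: lG.
  + by apply: contrapT; exact: exact_S.
  + have [q Aq fibO] := base y O oO Oy.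
    have pinj : injective (fun r : nat => pickle (q, r)).
      by move=> r r' /(pcan_inj (@pickleK _)) -[].
    have [r rS] := injective_escapes S pinj.
    have pq : p (pickle (q, r)) = q by rewrite /p pickleK.
    exists (pickle (q, r)); split; rewrite ?pq //.
    by apply: AU; rewrite pq.
- exists (pickle S) => //; rewrite /M pickleK /good uS sS eqxx /= => i iS.
  exact/SL.
Qed.

(** * K-partitions and zero-dimensional sets *)

Lemma Ktuple_cover (k : nat) (T : topologicalType) (A : 'I_k.+1 -> set T) :
  closed_Ktuple A -> open_cover (fun i => ~` A i).
Proof.
move=> [A0 cA]; split=> [i|]; first by rewrite openC.
by rewrite -setC_bigcap -[RHS]setC0; congr (~` _).
Qed.

Lemma closed_Kpartition (k : nat) (T : topologicalType) (P : set T)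
    (A : 'I_k.+1 -> set T) : Kpartition P A -> closed P.
Proof.
move=> [U [[_ oU] _] ->]; rewrite closedC; apply: bigcup_open => i _; exact: oU.
Qed.

Section KneighbourhoodsInNormal.
Variables (k : nat) (T : topologicalType) (A : 'I_k.+1 -> set T).
Hypotheses (nT : normal_space T) (KA : closed_Ktuple A).

(** Let F be a closed shrinking of the cover by the complements of the A i, and V i
a neighbourhood of F i inside the complement of A i whose boundary avoids D i.-1.
The closed cover of the sets C i = closure (V i) minus the V j with 0 < j < i, for
i > 0, and C 0 = the complement of the V j with j > 0, shrinks the given cover, and
a common point of all C i lies on the boundary of every V i with i > 0.  The sets
U i are the complements of the C i. *)
Lemma Kneighbourhood_avoiding (D : nat -> set T) :
  (forall j, zero_dim (D j)) ->
  exists2 U, Kneighbourhood U A &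
    forall j, (j < k)%N -> ~` (\bigcup_i U i) `<=` ~` D j.
Proof.
move=> zD; have cO := Ktuple_cover KA.
have [F [cF FO covF]] := closed_shrinking_ord nT cO.
have /choice[V VP] (i : 'I_k.+1) :=
  zero_dim_between nT (zD i.-1) (cF i) (cO.1 i) (FO i).
have oV i : open (V i) by have [] := VP i.
pose U (i : 'I_k.+1) := if i == ord0 then \bigcup_(j in [set j | j != ord0]) V j
  else ~` closure (V i) `|` \bigcup_(j in [set j | j != ord0 /\ (j < i)%N]) V j.
exists U; first split; first split.
- rewrite /Ktuple -subset0 => x Ux.
  have := Ux ord0 I; rewrite /U eqxx => -[j jP Vj].
  (* The first V i, i > 0, containing x shows that x is in C i. *)
  case: (@arg_minnP _ j (fun j => `[< j != ord0 /\ V j x >]) (@nat_of_ord _)).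
    exact/asboolP.
  move=> i /asboolP[i0 Vi] imin; have := Ux i I; rewrite /U (negPf i0).
  case=> [|[j' [j'0 j'i] Vj']]; first by apply; exact: subset_closure.
  by have := imin j'; rewrite leqNgt j'i => /(_ ltac:(by apply/asboolP)).
- move=> i; rewrite /U; case: eqP => _; first exact: bigcup_open.
  apply: openU; first by rewrite openC; exact: closed_closure.
  exact: bigcup_open.
- move=> i x Ax; rewrite /U; case: eqP => [i0|_]; last first.
    by left; have [_ _ + _] := VP i => /[apply]; exact.
  have [j Fj] := covF x; exists j; last by have [_ + _ _] := VP j; apply.
  by apply/eqP => j0; apply: (FO j x Fj); rewrite j0 -i0.
move=> j jk x nU.
pose i : 'I_k.+1 := Ordinal (jk : (j.+1 < k.+1)%N).
have nV i' : i' != ord0 -> ~ V i' x.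
  by move=> i'0 Vi'; apply: nU; exists ord0 => //; rewrite /U eqxx; exists i'.
have [_ _ _] := VP i; apply; split; last exact: nV.
by apply: contrapT => nclV; apply: nU; exists i => //; rewrite /U /=; left.
Qed.

Let others (U : 'I_k.+1 -> set T) i := \bigcap_(j in [set j | j != i]) U j.

(** Away from the closure of the intersection of the other members, U i may be
enlarged freely without creating a common point. *)
Lemma Kobs_closure (U : 'I_k.+1 -> set T) (i : 'I_k.+1) :
  open_Ktuple U -> Kobs U `<=` closure (others U i).
Proof.
move=> [U0 oU] x obs; apply: contrapT => nx; apply: obs.
exists (fun j => U j `|` if j == i then ~` closure (others U i) else set0).
  split; last by move=> j y Uy; left.
  split; last first.
    move=> j; apply: openU; first exact: oU.
    case: ifP => _; last exact: open0.
    by rewrite openC; exact: closed_closure.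
  rewrite /Ktuple -subset0 => y Vy.
  have othy : others U i y.
    by move=> j /= ji; have [//|] := Vy j I; rewrite (negPf ji).
  have [Uiy|] := Vy i I; last by rewrite eqxx; apply; exact: subset_closure.
  rewrite -U0 => j _; have [->//|ji] := eqVneq j i; exact: othy.
by exists i => //; right; rewrite eqxx.
Qed.

(** The W i are neighbourhoods of the A i whose closures have no common point.
Choose N between the union of the A i and that of the W i with boundary off D,
let U i be the part of W i in N, and add the whole exterior of N to U 0.  What
remains is in the boundary of N.  By [Kobs_closure] an obstruction point is in the
closure of the intersection of all members but U 0, which is inside the W i with
i > 0, and of all members but U 1.  As k >= 2, the latter intersection is still
taken over U 0 and some other member, which confines it to N and so to W 0.
Hence the obstruction point is in the closure of every W i, which is impossible. *)
Lemma Kneighbourhood_unobstructed (D : set T) : (2 <= k)%N -> zero_dim D ->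
  exists2 U, Kneighbourhood U A &
    Kobs U = set0 /\ ~` (\bigcup_i U i) `<=` ~` D.
Proof.
move=> k2 zD; have cO := Ktuple_cover KA.
have [F [cF FO covF]] := closed_shrinking_ord nT cO.
have /choice[V VP] (i : 'I_k.+1) := normal_between nT (cF i) (cO.1 i) (FO i).
pose W i := ~` closure (V i).
have oW i : open (W i) by rewrite openC; exact: closed_closure.
have AW i : A i `<=` W i by have [_ _ +] := VP i => VA x Ax /VA; exact.
have clW x : ~ forall i, closure (W i) x.
  move=> clWx; have [i Fx] := covF x; have [oV FV _] := VP i.
  have WV : W i `<=` ~` V i by move=> y + Vy; apply; exact: subset_closure.
  by apply: (nclosure_open oV WV (clWx i)); exact: FV.
have [] := @zero_dim_between T D (\bigcup_i A i) (\bigcup_i W i) nT zD.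
- by apply: closed_bigcup => [|i _]; [exact: finite_finset | exact: KA.2].
- by apply: bigcup_open => i _; exact: oW.
- by move=> x [i _ /AW Wx]; exists i.
move=> N [oN AN NW ND].
pose U i := (W i `&` N) `|` if i == ord0 then ~` closure N else set0.
have UW i : i != ord0 -> U i `<=` W i `&` N.
  by move=> i0 x [//|]; rewrite (negPf i0).
pose i1 : 'I_k.+1 := inord 1; pose i2 : 'I_k.+1 := inord 2.
have i1E : i1 = 1%N :> nat by rewrite inordK // ltnS ltnW.
have i2E : i2 = 2%N :> nat by rewrite inordK // ltnS.
have i10 : i1 != ord0 by rewrite -val_eqE /= i1E.
have i20 : i2 != ord0 by rewrite -val_eqE /= i2E.
have i21 : i2 != i1 by rewrite -val_eqE /= i1E i2E.
have U0N x : U ord0 x -> N x -> W ord0 x.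
  move=> [[Wx _] _|]; first exact: Wx.
  by rewrite ?eqxx => nN /subset_closure.
have KU : open_Ktuple U.
  split=> [|i]; last first.
    apply: openU; first exact: openI.
    case: ifP => _; last exact: open0.
    by rewrite openC; exact: closed_closure.
  rewrite /Ktuple -subset0 => x Ux; have [_ Nx] := UW i1 i10 x (Ux i1 I).
  apply: (clW x) => i; apply: subset_closure.
  have [->|i0] := eqVneq i ord0; first by apply: U0N => //; exact: Ux.
  by have [] := UW i i0 x (Ux i I).
exists U.
  split=> // i x Ax; left; split; first exact: AW.
  by apply: AN; exists i.
split.
  rewrite -subset0 => x obs; apply: (clW x) => i.
  have [->|i0] := eqVneq i ord0.
    apply: closureS (Kobs_closure i1 KU obs) => y oth.
    apply: U0N; first by apply: oth; rewrite /= eq_sym.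
    by have [] := UW i2 i20 y (oth i2 i21).
  apply: closureS (Kobs_closure ord0 KU obs) => y oth.
  by have [] := UW i i0 y (oth i i0).
move=> x nU; apply: ND; split.
  apply: contrapT => nN; apply: nU; exists ord0 => //.
  by right; rewrite eqxx.
move=> Nx; have [i _ Wx] := NW x (subset_closure Nx).
by apply: nU; exists i => //; left.
Qed.

End KneighbourhoodsInNormal.

Definition zero_dim_covered (T : topologicalType) (M : nat) : Prop :=
  exists D : nat -> set T,
    (forall j, zero_dim (D j)) /\ forall x, exists2 j, (j < M)%N & D j x.

Lemma zero_dim_coveredW (T : topologicalType) (M N : nat) :
  (M <= N)%N -> zero_dim_covered T M -> zero_dim_covered T N.
Proof.
move=> MN [D [zD cD]]; exists D; split=> // x.
by have [j jM Dj] := cD x; exists j => //; exact: leq_trans MN.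
Qed.

Lemma zero_dim_covered_closed (T : topologicalType) (P : set T)
    (D : nat -> set T) (r M : nat) :
  closed P -> (forall j, zero_dim (D j)) ->
  (forall x, exists2 j, (j < r + M)%N & D j x) ->
  (forall j, (j < r)%N -> P `<=` ~` D j) -> zero_dim_covered P M.
Proof.
move=> cP zD cD PD.
exists (fun j => set_val @^-1` (D (r + j)%N `&` P)); split=> [j|x].
  apply: zero_dim_preimage; first exact: subIsetr.
  exact: zero_dimI_closed.
have [j jM Dj] := cD (set_val x); have Px := val_in x.
have [jr|rj] := ltnP j r; first by have := PD j jr _ Px.
by exists (j - r)%N; rewrite ?ltn_subLR // subnKC.
Qed.

(** A K-partition that avoids the first k zero-dimensional sets is covered by the
traces of the others. *)
Theorem KInd_le_of_zero_dim (k m : nat) (T : topologicalType) :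
  completely_normal T -> zero_dim_covered T (k * m.+1) ->
  KInd_le k (ord_of_nat m) T.
Proof.
elim: m T => [|m IH] T cnT [D [zD cD]]; constructor=> A KA;
  have nT := completely_normal_normal cnT;
  have [U UA UD] := Kneighbourhood_avoiding nT KA zD;
  exists (~` \bigcup_i U i); try by exists U.
- left; rewrite -subset0 => x nU; have [j jk Dj] := cD x.
  by apply: (UD j _ x nU Dj); rewrite muln1 in jk.
- right; exists (ord_of_nat m); first by exists tt; exact: ole_refl.
  apply: IH; first exact: completely_normal_sub.
  apply: (zero_dim_covered_closed (D := D) (r := k)) => //.
    by apply: (closed_Kpartition (A := A)); exists U.
  by move=> x; have [j jM Dj] := cD x; exists j => //; rewrite -mulnS.
Qed.

(** * From K-Ind to covering dimension *)

(** For M = n + 2 and a normal space T this property characterizes dim T <= n;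
it is the form of covering dimension that suits K-tuples. *)
Definition cover_shrinkable (T : topologicalType) (M : nat) : Prop :=
  forall O : nat -> set T, (forall i, open (O i)) ->
  (forall x, exists2 i, (i < M)%N & O i x) ->
  exists V : nat -> set T, [/\ forall i, open (V i), forall i, V i `<=` O i,
    forall x, exists2 i, (i < M)%N & V i x &
    forall x, ~ forall i, (i < M)%N -> V i x].

(** Of the given cover O, keep the first k members and lump the others into one.
A K-partition P for the complements amounts to a closed shrinking C of this
cover of k + 1 sets with common part P.  On P, which lies in the lump, the last
M + 1 members of O have a shrinking E without a common point.  It extends to a
closed shrinking H of these members over the last set of C: replace O i by the
open set O' i that agrees with O i off P and with E i on P.  The first k sets of C
and the sets H i then shrink O, and a common point of all of them would be in P
and in all E i. *)
Lemma cover_shrinkable_join (k M : nat) (T : topologicalType) :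
  normal_space T ->
  (forall A : 'I_k.+1 -> set T, closed_Ktuple A ->
     exists2 P : set T, Kpartition P A & cover_shrinkable P M.+1) ->
  cover_shrinkable T (k + M.+1).
Proof.
move=> nT KP O oO covO.
pose rest := \bigcup_(i in [set i | (i <= M)%N]) O (k + i)%N.
pose A (i : 'I_k.+1) := ~` (if (i < k)%N then O i else rest).
have orest : open rest by apply: bigcup_open.
have KA : closed_Ktuple A.
  split; last by move=> i; rewrite /A closedC; case: ifP.
  rewrite /Ktuple -subset0 => x Ax; have [i iM Oi] := covO x.
  have [ik|ki] := ltnP i k.
    have ik1 : (i < k.+1)%N by rewrite ltnS ltnW.
    by have := Ax (Ordinal ik1) I; rewrite /A /= ik; apply.
  have := Ax ord_max I; rewrite /A /= ltnn; apply; exists (i - k)%N => /=.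
    by rewrite -ltnS ltn_subLR.
  by rewrite subnKC.
have [P PA shrP] := KP A KA.
have cP := closed_Kpartition PA; have [U [[U0 oU] AU] PE] := PA.
pose C (i : 'I_k.+1) := ~` U i.
have cC i : closed (C i) by rewrite closedC.
have CO (i : 'I_k.+1) : (i < k)%N -> C i `<=` O i.
  by move=> ik x nU; apply: contrapT => nO; apply/nU/AU; rewrite /A ik.
have Crest : C ord_max `<=` rest.
  by move=> x nU; apply: contrapT => nO; apply/nU/AU; rewrite /A /= ltnn.
have PC x : P x <-> forall i, C i x.
  rewrite PE; split=> [nU i Ui|Cx [i _ /Cx]//]; by apply: nU; exists i.
have [|x|E [oE EO covE E0]] := shrP (fun i => set_val @^-1` O (k + i)%N).
- by move=> i; exact: open_preimage_val.
- by have [i iM Oi] := Crest _ ((PC _).1 (val_in x) ord_max); exists i.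
have /choice[G GE] : forall i, exists G : set T,
    open G /\ E i = set_val @^-1` G.
  by move=> i; have [G oG EG] := open_valE (oE i); exists G.
pose O' i := O (k + i)%N `&` (~` P `|` G i).
have [||x Cx|H [cH HO covH]] := @closed_shrinking _ nT M.+1 O' (C ord_max).
- move=> i; apply: openI => //; apply: openU; first by rewrite openC.
  by have [] := GE i.
- exact: cC.
- have [Px|nPx] := pselect (P x); last first.
    by have [i iM Oi] := Crest x Cx; exists i => //; split=> //; left.
  pose y : P := exist _ x (mem_set Px).
  have [i iM Ey] := covE y; exists i => //; split; first exact: EO _ _ Ey.
  by right; have [_ EG] := GE i; rewrite EG in Ey.
pose C' i := if (i < k)%N then C (inord i) else H (i - k)%N `&` C ord_max.
have C'C (i : 'I_k.+1) : (i < k)%N -> C' i = C i.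
  by move=> ik; rewrite /C' ik inord_val.
have [i|i x|x Cx|W [oW CW WO W0]] := @open_swelling _ nT (k + M.+1) O C' oO.
- by rewrite /C'; case: ifP => _ //; exact: closedI.
- rewrite /C'; case: ltnP => [ik Cx|ki [/HO[+ _] _]].
    have iE : (inord i : 'I_k.+1) = i :> nat by rewrite inordK // ltnS ltnW.
    by have := CO (inord i); rewrite iE => /(_ ik x Cx).
  by rewrite subnKC.
- have C'H i : (i <= M)%N -> (H i `&` C ord_max) x.
    move=> iM; have := Cx (k + i)%N; rewrite ltn_add2l => /(_ iM).
    by rewrite /C' ltnNge leq_addr /= addKn.
  have [_ Cmax] := C'H 0%N isT.
  have Px : P x.
    apply/PC => i; have [ik|ki] := ltnP i k.
      by rewrite -C'C //; apply: Cx; rewrite ltn_addr.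
    suff -> : i = ord_max by [].
    by apply/val_inj/eqP; rewrite eqn_leq ki -ltnS ltn_ord.
  pose y : P := exist _ x (mem_set Px).
  apply: (E0 y) => i iM; have [_ ->] := GE i.
  by have [/HO[_ [|]]] := C'H i iM.
exists W; split=> // x.
have [i _ Ci] : (\bigcup_i C i) x.
  by rewrite /C -setC_bigcap U0 setC0.
have [ik|ki] := ltnP i k.
  exists i; first by rewrite ltn_addr.
  by apply: CW; rewrite C'C.
have iE : i = ord_max.
  by apply/val_inj/eqP; rewrite eqn_leq ki -ltnS ltn_ord.
rewrite iE in Ci; have [j jM Hj] := covH x Ci.
exists (k + j)%N; first by rewrite ltn_add2l.
by apply: CW; rewrite /C' ltnNge leq_addr /= addKn.
Qed.

Lemma olt_ole_trans (a b c : ord) : olt a b -> ole b c -> olt a c.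
Proof.
case: b c => J f [L g] [j aj] /(_ j)[l jl].
by exists l; exact: ole_trans jl.
Qed.

Lemma cover_shrinkable_empty (T : topologicalType) (M : nat) :
  (T -> False) -> cover_shrinkable T M.
Proof.
move=> T0 O _ _; exists (fun=> set0); split=> [i|i x|x|x]; first exact: open0.
all: by case: (T0 x).
Qed.

(** The first alternative is K-Ind T = -1, so that the hypothesis says
K-Ind T < m and the induction can start at the empty space. *)
Lemma cover_shrinkable_of_KInd (k m : nat) (T : topologicalType) :
  completely_normal T ->
  (T -> False) \/ (exists2 b, olt b (ord_of_nat m) & KInd_le k b T) ->
  cover_shrinkable T (k * m).+1.
Proof.
elim: m T => [|m IH] T cnT KT.
  have T0 : T -> False by case: KT => // -[b []].
  exact: cover_shrinkable_empty.
case: KT => [T0|[b [[] bm] [Kb]]]; first exact: cover_shrinkable_empty.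
rewrite mulnS -addnS; apply: cover_shrinkable_join => [|A KA].
  exact: completely_normal_normal.
have [P PA Pb] := Kb A KA; exists P => //; apply: IH.
  exact: completely_normal_sub.
case: Pb => [->|[b' b'b KP]].
  by left=> x; exact: (val_in x).
by right; exists b' => //; exact: olt_ole_trans b'b bm.
Qed.

(** Group the members of U by the values of c, shrink the cover formed by the
unions of the groups, and intersect each member with the shrinking of its group. *)
Lemma cover_shrinkable_merge (T : topologicalType) (M m : nat)
    (U : 'I_m -> set T) (c : 'I_m -> nat) :
  cover_shrinkable T M -> open_cover U -> (forall i, c i < M)%N ->
  exists V : 'I_m -> set T, [/\ open_cover V, forall i, V i `<=` U i &
    forall x, exists2 t, (t < M)%N & forall i, c i = t -> ~ V i x].
Proof.
move=> shT [oU covU] cM.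
pose O t := \bigcup_(i in [set i | c i = t]) U i.
have [t|x|W [oW WO covW W0]] := shT O.
- exact: bigcup_open.
- have [i _ Ui] : (\bigcup_i U i) x by rewrite covU.
  by exists (c i) => //; exists i.
exists (fun i => U i `&` W (c i)); split=> [|i x []//|x].
  split=> [i|]; first exact: openI.
  apply/seteqP; split=> // x _; have [t tM Wt] := covW x.
  by have [i /= ct Ui] := WO t x Wt; exists i => //; rewrite ct.
have /existsNP[t /not_implyP[tM nW]] := W0 x.
by exists t => // i ct [_ Wi]; apply: nW; rewrite -ct.
Qed.

(** Treat the sets S of n + 2 indices one after the other, shrinking the cover each
time so that its members with index in S lose their common points; further
shrinking does not bring these back. *)
Lemma covdim_le_of_shrinkable (T : topologicalType) (n : nat) :
  cover_shrinkable T n.+2 -> covdim_le T n.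
Proof.
move=> shT m U cU.
suff [V [cV VU VS]] : exists V : 'I_m -> set T, [/\ open_cover V,
    forall i, V i `<=` U i &
    forall S, S \in enum {set 'I_m} -> #|S| = n.+2 ->
      forall x, ~ forall i, i \in S -> V i x].
  exists m, V; split=> // [i|x]; first by exists i.
  rewrite leqNgt; apply/negP => ltn.
  pose s := take n.+2 (enum [pred i | `[< V i x >]]).
  apply: (VS [set i in s] _ _ x); first by rewrite mem_enum.
    rewrite cardsE (card_uniqP _) ?take_uniq ?enum_uniq //.
    by rewrite size_takel // -cardE.
  by move=> i; rewrite inE => /mem_take; rewrite mem_enum inE.
elim: (enum _) => [|S Ss [V [cV VU VS]]]; first by exists U; split=> // i.
have [cS|ncS] := eqVneq #|S| n.+2; last first.
  exists V; split=> // S'; rewrite inE => /predU1P[->|]; last exact: VS.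
  by move=> cS; rewrite cS eqxx in ncS.
(* Each index in S forms its own group, except for the last one, which is grouped
   with all indices outside S; those have index #|S| = n + 2 in enum S. *)
pose c (i : 'I_m) := minn (index i (enum S)) n.+1.
have [i|W [cW WV WS]] := cover_shrinkable_merge (c := c) shT cV.
  by rewrite /c ltnS geq_minr.
exists W; split=> // [i x /WV/VU//|S'].
rewrite inE => /predU1P[->|S'S] cS' x SW; last first.
  by apply: (VS S' S'S cS' x) => i iS; apply: WV; exact: SW.
have [t tn nW] := WS x.
have tS : (t < size (enum S))%N by rewrite -cardE cS.
have /card_gt0P[i0 _] : (0 < #|S|)%N by rewrite cS.
have iS : nth i0 (enum S) t \in S by rewrite -mem_enum mem_nth.
apply: (nW (nth i0 (enum S) t)); last exact: SW.
by rewrite /c index_uniq ?enum_uniq //; apply/minn_idPl.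
Qed.

(** * The theorem *)

Theorem proposition2p8 (R : realType) (X : metricType R) (k n : nat)
    (hk : (2 <= k)%N) (hn : (1 <= n)%N) (hdim : covdim X = Val (k * n)%N) :
  dimval_eq oeq (KInd k X) (Val (ord_of_nat n)) /\ Kstr k X = 0%N.
Proof.
have cnX := @pseudometric_completely_normal R X.
have nX := completely_normal_normal cnX.
move: hdim; rewrite /covdim /dim_value.
case: pselect => // X0; case: pselect => //= e [].
case: (cid e) => d [/= dimX mindim] dE; rewrite {d}dE in dimX mindim.
case: n hn dimX mindim => // n _ dimX mindim.
have [D [zD cD]] := zero_dim_decomposition dimX.
have KX : KInd_le k (ord_of_nat n.+1) X.
  apply: KInd_le_of_zero_dim => //.
  apply: (@zero_dim_coveredW _ (k * n.+1).+1); last by exists D.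
  by rewrite [leqRHS]mulnS -add1n leq_add2r; apply: leq_trans hk.
have Kmin b : KInd_le k b X -> ole (ord_of_nat n.+1) b.
  move=> Kb; have [//|bn] := ole_total (ord_of_nat n.+1) b.
  have shX : cover_shrinkable X (k * n.+1).+1.
    by apply: cover_shrinkable_of_KInd => //; right; exists b.
  have kn : (0 < k * n.+1)%N by rewrite muln_gt0 (leq_trans _ hk).
  have dimX' : covdim_le X (k * n.+1).-1.
    by apply: covdim_le_of_shrinkable; rewrite prednK.
  by have := mindim _ dimX'; rewrite leqNgt prednK // leqnn.
have [a aE [an na]] : exists2 a, KInd k X = Val a & oeq a (ord_of_nat n.+1).
  rewrite /KInd /dim_value; case: pselect => // X0'.
  case: pselect => [e'|]; last by case; exists (ord_of_nat n.+1); split.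
  case: (cid e') => a [/= Ka mina]; exists a => //.
  by split; [exact: mina | exact: Kmin].
rewrite aE; split=> //=.
rewrite /Kstr aE; case: asboolP => // -[]; right=> A KA.
have [U UA [obsU PD]] := Kneighbourhood_unobstructed nX KA hk (zD 0%N).
exists U; split=> //; apply/KInd_ltP; right.
exists (ord_of_nat n); first by apply: olt_ole_trans na; exists tt; exact: ole_refl.
apply: KInd_le_of_zero_dim; first exact: completely_normal_sub.
apply: (zero_dim_covered_closed (D := D) (r := 1)) => //.
  by apply: (closed_Kpartition (A := A)); exists U.
by case.
Qed.
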